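(* Let $(R,\mathfrak{m})$ be a Noetherian local ring and let $\varphi$ be a self-map of finite length of $R$. Assume that every minimal prime ideal $\mathfrak{p}_i$ of $R$ satisfies $\varphi(\mathfrak{p}_i)R\subseteq\mathfrak{p}_i$, and let $\overline\varphi_i$ be the self-map induced by $\varphi$ on $R/\mathfrak{p}_i$. Then $$h_{\mathrm{alg}}(\varphi,R)=\max\{h_{\mathrm{alg}}(\overline\varphi_i,R/\mathfrak{p}_i)\mid \mathfrak{p}_i\in\operatorname{Min}(R)\}.$$
   Context: $\operatorname{Min}(R)$ denotes the set of minimal prime ideals of $R$. A self-map of finite length of a Noetherian local ring $(A,\mathfrak{n})$ is a ring endomorphism $\psi$ with $\psi(\mathfrak{n})\subseteq\mathfrak{n}$ and $\psi(\mathfrak{n})A$ $\mathfrak{n}$-primary; if $\mathfrak{a}$ is an ideal with $\varphi(\mathfrak{a})R\subseteq\mathfrak{a}$, then $\varphi$ induces such a self-map on $R/\mathfrak{a}$. Put $\lambda(\psi^n):=\ell_A(A/\psi^n(\mathfrak{n})A)$; the algebraic entropy is $h_{\mathrm{alg}}(\psi,A):=\lim_{n\to\infty}\frac1n\log\lambda(\psi^n)$ (the limit exists). *)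

(* Defs.v *)
From Stdlib Require Import Reals.
From HB Require Import structures.
From mathcomp Require Import all_boot all_order all_algebra.
Set Implicit Arguments. Unset Strict Implicit. Unset Printing Implicit Defensive.
Import GRing.Theory.

Local Open Scope ring_scope.

Section CommAlg.
Variable A : comNzRingType.

Definition incl_set (I J : A -> Prop) : Prop := forall x, I x -> J x.

Definition is_ideal (I : A -> Prop) : Prop :=
  I 0 /\ (forall x y, I x -> I y -> I (x + y)) /\ (forall a x, I x -> I (a * x)).

Definition proper_ideal (I : A -> Prop) : Prop := is_ideal I /\ ~ I 1.

Definition prime_ideal (P : A -> Prop) : Prop :=
  proper_ideal P /\ (forall x y, P (x * y) -> P x \/ P y).

Definition minimal_prime (P : A -> Prop) : Prop :=
  prime_ideal P /\ (forall Q, prime_ideal Q -> incl_set Q P -> incl_set P Q).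

Definition maximal_ideal (M : A -> Prop) : Prop :=
  proper_ideal M /\ (forall J, proper_ideal J -> incl_set M J -> incl_set J M).

Definition local_ring (m : A -> Prop) : Prop :=
  maximal_ideal m /\ (forall M, maximal_ideal M -> forall x, M x <-> m x).

Definition noetherian : Prop :=
  forall I : nat -> A -> Prop, (forall n, is_ideal (I n)) ->
    (forall n, incl_set (I n) (I n.+1)) ->
    exists N, forall n, (N <= n)%N -> incl_set (I n) (I N).

Definition ideal_gen (S : A -> Prop) : A -> Prop :=
  fun x => forall J, is_ideal J -> incl_set S J -> J x.

Definition image_set (f : A -> A) (S : A -> Prop) : A -> Prop :=
  fun y => exists x, S x /\ y = f x.

Definition primary_to (m I : A -> Prop) : Prop :=
  proper_ideal I /\ incl_set I m /\ (forall x, m x -> exists k, I (x ^+ k)).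

(* length of the A-module A/I : the supremum of the lengths k of strict chains
   of ideals I = J_0 < J_1 < ... < J_k = A  (submodules of A/I) *)
Definition chain_of_length (I : A -> Prop) (k : nat) : Prop :=
  exists J : nat -> A -> Prop,
    (forall x, J 0%N x <-> I x) /\ (forall x, J k x) /\
    (forall i, (i <= k)%N -> is_ideal (J i)) /\
    (forall i, (i < k)%N -> incl_set (J i) (J i.+1) /\ ~ incl_set (J i.+1) (J i)).

Definition length_quot (I : A -> Prop) (l : nat) : Prop :=
  chain_of_length I l /\ (forall k, chain_of_length I k -> (k <= l)%N).

Definition finite_length_selfmap (m : A -> Prop) (psi : {rmorphism A -> A}) : Prop :=
  incl_set (image_set psi m) m /\ primary_to m (ideal_gen (image_set psi m)).

Definition lambda_len (m : A -> Prop) (psi : {rmorphism A -> A}) (n l : nat) : Prop :=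
  length_quot (ideal_gen (image_set (iter n psi) m)) l.

Definition alg_entropy (m : A -> Prop) (psi : {rmorphism A -> A}) (h : R) : Prop :=
  exists lam : nat -> nat, (forall n, lambda_len m psi n (lam n)) /\
    Un_cv (fun n => Rdiv (ln (INR (lam n))) (INR n)) h.

End CommAlg.

(* (B, pi, psi, n) is a model of the quotient R/p together with the self-map
   induced by phi: pi : R -> B is surjective with kernel p, psi o pi = pi o phi,
   and n is the maximal ideal of the local ring B. *)
Definition induced_quotient (R0 : comNzRingType) (phi : {rmorphism R0 -> R0})
    (p : R0 -> Prop) (B : comNzRingType) (pi : {rmorphism R0 -> B})
    (psi : {rmorphism B -> B}) (n : B -> Prop) : Prop :=
  (forall b, exists x, pi x = b) /\ (forall x, pi x = 0 <-> p x) /\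
  (forall x, psi (pi x) = pi (phi x)) /\ local_ring n.

(* Main.v *)
(** Killing a minimal prime can only shorten chains of ideals, so no quotient has
larger entropy.  Conversely, a prime filtration of [R0] gives minimal primes
[p_1, ..., p_r], possibly repeated, with
[len (R0/phi^n(m)) <= sum_i len (R0/(p_i + phi^n(m)))] for all [n].  The lengths on
the right are submultiplicative in [n], because extending a composition series of
[R0/(p_i + phi^b(m))] along [phi^a] gives a filtration whose factors are cyclic and
killed by [p_i + phi^a(m)]; so by Fekete's argument one of them already grows at
the rate [h].  Lengths in [R0/p] are computed in [R0], as lengths modulo [p + I]. *)
Require Import Defs.
From Stdlib Require Import Reals Lra Classical ClassicalEpsilon.
From HB Require Import structures.
From mathcomp Require Import all_boot all_order all_algebra.
Set Implicit Arguments. Unset Strict Implicit. Unset Printing Implicit Defensive.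
Import GRing.Theory Defs.

Local Open Scope ring_scope.
Local Open Scope quotient_scope.

(** Induction on [r]: the new index displaces the one already found only when its set is contained
    in that one. Applied to the primes of a filtration, this yields a minimal prime below a given
    prime. *)
Lemma finite_family_minimal (T : Type) (q : nat -> T -> Prop) (r : nat) (Q : T -> Prop) :
  (exists2 i, (i < r)%N & forall x, q i x -> Q x) ->
  exists2 i, (i < r)%N & (forall x, q i x -> Q x) /\
    forall j, (j < r)%N -> (forall x, q j x -> q i x) -> forall x, q i x -> q j x.
Proof.
elim: r => [[]//|r IH] [i0 ir0 i0Q].
have [ex|nex] := classic (exists2 i, (i < r)%N & forall x, q i x -> Q x).
  have [i ir [iQ imin]] := IH ex.
  have [ri|nri] := classic (forall x, q r x -> q i x).
    exists r => //; split=> [x /ri /iQ//|j]; rewrite ltnS leq_eqVlt.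
    move=> /orP[/eqP-> //|jr] jsub x /ri; apply: imin => // y /jsub; exact: ri.
  exists i; first exact: leq_trans ir _.
  split=> // j; rewrite ltnS leq_eqVlt => /orP[/eqP-> //|jr]; exact: imin.
have i0E : i0 = r.
  move: ir0; rewrite ltnS leq_eqVlt => /orP[/eqP//|ir]; case: nex.
  by exists i0.
rewrite i0E in i0Q; exists r => //; split=> // j; rewrite ltnS leq_eqVlt.
move=> /orP[/eqP->//|jr] jsub; case: nex; exists j => // x /jsub; exact: i0Q.
Qed.

(** * Sums of ideals, adjunction of an element, colon ideals *)

Section Ideals.
Variable A : comNzRingType.
Implicit Types (I J K Q : A -> Prop) (x y : A).

Definition add_ideal I J : A -> Prop := fun z => exists x y, [/\ I x, J y & z = x + y].
Definition adjoin I x : A -> Prop := fun z => exists y r, I y /\ z = y + r * x.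
Definition colon I x : A -> Prop := fun r => I (r * x).

Lemma ideal0 I : is_ideal I -> I 0.
Proof. by case. Qed.

Lemma idealD I x y : is_ideal I -> I x -> I y -> I (x + y).
Proof. by case=> _ [+ _]; apply. Qed.

Lemma idealM I a x : is_ideal I -> I x -> I (a * x).
Proof. by case=> _ [_ +]; apply. Qed.

Lemma idealB I x y : is_ideal I -> I x -> I y -> I (x - y).
Proof.
by move=> iI Ix Iy; rewrite -mulN1r; apply: idealD => //; apply: idealM.
Qed.

Lemma ideal_full I : is_ideal I -> I 1 -> forall x, I x.
Proof. by move=> iI I1 x; rewrite -(mulr1 x); apply: idealM. Qed.

Lemma ideal_add_ideal I J : is_ideal I -> is_ideal J -> is_ideal (add_ideal I J).
Proof.
move=> iI iJ; split; first by exists 0, 0; split; [exact: ideal0|exact: ideal0|rewrite addr0].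
split=> [_ _ [a [b [Ia Jb ->]]] [c [d [Ic Jd ->]]] | r _ [a [b [Ia Jb ->]]]].
  by exists (a + c), (b + d); split; [apply: idealD|apply: idealD|rewrite addrACA].
by exists (r * a), (r * b); split; [apply: idealM|apply: idealM|rewrite mulrDr].
Qed.

Lemma ideal_adjoin I x : is_ideal I -> is_ideal (adjoin I x).
Proof.
move=> iI; split; first by exists 0, 0; split; [apply: ideal0|rewrite mul0r addr0].
split=> [_ _ [a [r [Ia ->]]] [b [s [Ib ->]]] | t _ [a [r [Ia ->]]]].
  by exists (a + b), (r + s); split; [apply: idealD|rewrite mulrDl addrACA].
by exists (t * a), (t * r); split; [apply: idealM|rewrite mulrDr mulrA].
Qed.

Lemma ideal_colon I x : is_ideal I -> is_ideal (colon I x).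
Proof.
move=> iI; rewrite /colon; split; first by rewrite mul0r; apply: ideal0.
split=> [a b Ia Ib | r a Ia]; first by rewrite mulrDl; apply: idealD.
by rewrite -mulrA; apply: idealM.
Qed.

Lemma ideal_ideal_gen (S : A -> Prop) : is_ideal (ideal_gen S).
Proof.
split=> [J iJ _|]; first exact: ideal0.
split=> [x y Sx Sy J iJ SJ | a x Sx J iJ SJ].
  by apply: idealD => //; [apply: Sx|apply: Sy].
by apply: idealM => //; apply: Sx.
Qed.

Lemma mem_ideal_gen (S : A -> Prop) x : S x -> ideal_gen S x.
Proof. by move=> Sx J _; apply. Qed.

Lemma sub_adjoin I x : incl_set I (adjoin I x).
Proof. by move=> y Iy; exists y, 0; rewrite mul0r addr0. Qed.

Lemma mem_adjoin I x : is_ideal I -> adjoin I x x.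
Proof. by move=> iI; exists 0, 1; split; [apply: ideal0|rewrite mul1r add0r]. Qed.

Lemma adjoin_sub I J x : is_ideal J -> incl_set I J -> J x -> incl_set (adjoin I x) J.
Proof.
by move=> iJ IJ Jx _ [y [r [/IJ Jy ->]]]; apply: idealD => //; apply: idealM.
Qed.

Lemma sub_add_ideall I J : is_ideal J -> incl_set I (add_ideal I J).
Proof. by move=> iJ x Ix; exists x, 0; split; [|apply: ideal0|rewrite addr0]. Qed.

Lemma sub_add_idealr I J : is_ideal I -> incl_set J (add_ideal I J).
Proof. by move=> iI x Jx; exists 0, x; split; [apply: ideal0| |rewrite add0r]. Qed.

Lemma add_ideal_sub I J K : is_ideal K -> incl_set I K -> incl_set J K ->
  incl_set (add_ideal I J) K.
Proof. by move=> iK IK JK _ [x [y [/IK Kx /JK Ky ->]]]; apply: idealD. Qed.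

(** * Chains of ideals and bounds on length *)

Inductive ideal_chain : (A -> Prop) -> nat -> Prop :=
| ideal_chain_top I : (forall x, I x) -> ideal_chain I 0
| ideal_chain_step I J k : is_ideal I -> incl_set I J -> ~ incl_set J I ->
    ideal_chain J k -> ideal_chain I k.+1.

Lemma is_ideal_top I : (forall x, I x) -> is_ideal I.
Proof. by move=> IT; split. Qed.

Lemma ideal_chain_ideal I k : ideal_chain I k -> is_ideal I.
Proof. by case=> // J JT; apply: is_ideal_top. Qed.

(** The inductive form removes the lowest ideal of a chain, so that arguments on lengths become
    inductions instead of manipulations of indexed families. *)
Lemma chain_of_lengthP I k : is_ideal I -> chain_of_length I k <-> ideal_chain I k.
Proof.
move=> iI; split=> [[J]|].
  elim: k I J iI => [|k IH] I J iI [J0 [Jk [iJ sJ]]].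
    by constructor=> x; apply/J0/Jk.
  have [J01 J10] := sJ 0%N isT.
  apply: (@ideal_chain_step _ (J 1%N)) => // [x /J0 /J01 //| J1I |].
    by apply: J10 => x /J1I /J0.
  apply: (IH _ (fun i => J i.+1)); first exact: iJ.
  by split=> //; split=> //; split=> i ik; [apply: iJ|apply: sJ].
elim=> {iI k}[{}I IT | {}I J k iI IJ JI _ [L [L0 [Lk [iL sL]]]]].
  exists (fun _ => I); split=> //; split=> //; split=> // i _; exact: is_ideal_top.
exists (fun i => if i is i'.+1 then L i' else I).
split=> //; split=> //; split=> [[|i] //|[_|i]]; [exact: iL| |exact: sL].
by split=> [x /IJ /L0 //|LI]; apply: JI => x /L0 /LI.
Qed.

(** Ideals are predicates, compared by mutual inclusion and not by equality; this lemma and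
    [length_quot_ext] take the place of rewriting. *)
Lemma ideal_chain_ext I J k : is_ideal I -> incl_set I J -> incl_set J I ->
  ideal_chain J k -> ideal_chain I k.
Proof.
move=> iI IJ JI cJ; case: cJ IJ JI => [{}J JT _ JI|{}J J' k' iJ JJ' J'J cJ' IJ JI].
  by constructor=> x; apply: JI.
by apply: ideal_chain_step cJ' => // [x /IJ /JJ'//|J'I]; apply: J'J => x /J'I /IJ.
Qed.

(** Either [I] has the same elements as [J] and the chain is kept, or [I] prolongs it by one
    step. *)
Lemma ideal_chain_sub I J k : is_ideal I -> incl_set I J -> ideal_chain J k ->
  exists2 k', (k <= k')%N & ideal_chain I k'.
Proof.
move=> iI IJ cJ; have [JI|nJI] := classic (incl_set J I); last first.
  by exists k.+1; [exact: leqnSn|apply: ideal_chain_step cJ].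
by exists k => //; apply: ideal_chain_ext cJ.
Qed.

Definition len_le I l := forall k, ideal_chain I k -> (k <= l)%N.

Lemma len_le_sub I J l : is_ideal I -> incl_set I J -> len_le I l -> len_le J l.
Proof.
move=> iI IJ Il k /(ideal_chain_sub iI IJ)[k' kk' /Il].
exact: leq_trans.
Qed.

Lemma len_le_top I l : (forall x, I x) -> len_le I l.
Proof. by move=> + k cI; case: cI => // {}I J k' _ _ JI _ IT; case: JI. Qed.

(* A strict inclusion [J < J'] stays strict after adjoining [x] or after taking
   colons by [x], by the modular law. *)
Lemma ideal_chain_adjoin_colon I x k : ideal_chain I k ->
  exists k1 k2, [/\ (k <= k1 + k2)%N, ideal_chain (adjoin I x) k1 &
                    ideal_chain (colon I x) k2].
Proof.
elim=> {I k}[I IT | I J k iI IJ JI cJ [k1 [k2 [kk c1 c2]]]].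
  exists 0%N, 0%N; split=> //; constructor=> y; last exact: IT.
  exact: sub_adjoin (IT y).
have iA := ideal_adjoin x iI; have iC := ideal_colon x iI.
have AA : incl_set (adjoin I x) (adjoin J x).
  by move=> _ [y [r [/IJ Jy ->]]]; exists y, r.
have CC : incl_set (colon I x) (colon J x) by move=> y /IJ.
have [k1' kk1 c1'] := ideal_chain_sub iA AA c1.
have [k2' kk2 c2'] := ideal_chain_sub iC CC c2.
have [sA|nA] := classic (incl_set (adjoin J x) (adjoin I x)); last first.
  exists k1.+1, k2'; split=> //; last exact: ideal_chain_step c1.
  by rewrite addSn ltnS (leq_trans kk)// leq_add2l.
have [sC|nC] := classic (incl_set (colon J x) (colon I x)); last first.
  exists k1', k2.+1; split=> //; last exact: ideal_chain_step c2.
  by rewrite addnS ltnS (leq_trans kk)// leq_add2r.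
exfalso; apply: JI => z Jz; have [y [r [Iy zE]]] := sA z (sub_adjoin _ Jz).
have : colon J x r.
  rewrite /colon; have -> : r * x = z - y by rewrite zE addrC addKr.
  by apply: idealB => //; [exact: ideal_chain_ideal cJ|exact: IJ].
by move=> /sC Irx; rewrite zE; apply: idealD.
Qed.

(** Subadditivity of length along the exact sequence [0 -> A/(I : x) -> A/I -> A/(I + Ax) -> 0]. *)
Lemma len_le_adjoin_colon I x l1 l2 :
  len_le (adjoin I x) l1 -> len_le (colon I x) l2 -> len_le I (l1 + l2).
Proof.
move=> h1 h2 k /(ideal_chain_adjoin_colon x)[k1 [k2 [kk /h1 kl1 /h2 kl2]]].
by apply: leq_trans kk _; apply: leq_add.
Qed.

Lemma length_quot_len_le I l : is_ideal I -> length_quot I l -> len_le I l.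
Proof. by move=> iI [_ H] k /(chain_of_lengthP _ iI) /H. Qed.

(** Lower the bound until some chain attains it; properness of [I] gives a chain of length 1, which
    stops the descent above zero. *)
Lemma length_quot_exists I l : is_ideal I -> ~ I 1 -> len_le I l ->
  exists l', length_quot I l'.
Proof.
move=> iI nI1 Il.
have c1 : ideal_chain I 1.
  apply: (@ideal_chain_step _ (fun _ => True)) => // [sI|]; last by constructor.
  exact/nI1/sI.
elim: l Il => [|l IH] Il; first by have := Il _ c1.
have [c|nc] := classic (ideal_chain I l.+1).
  by exists l.+1; split=> [|k /(chain_of_lengthP _ iI)/Il //]; apply/chain_of_lengthP.
apply: IH => k ck; have := Il _ ck; rewrite leq_eqVlt => /orP[/eqP kE|//].
by rewrite kE in ck.
Qed.

Lemma length_quot_gt0 I l : is_ideal I -> ~ I 1 -> length_quot I l -> (0 < l)%N.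
Proof.
move=> iI nI1 /(length_quot_len_le iI); apply.
apply: (@ideal_chain_step _ (fun _ => True)) => // [sI|]; last by constructor.
exact/nI1/sI.
Qed.

Lemma length_quot_ext I J l : is_ideal I -> incl_set I J -> incl_set J I ->
  length_quot J l -> length_quot I l.
Proof.
move=> iI IJ JI [cJ mJ]; have iJ : is_ideal J.
  split; first by apply: IJ; apply: ideal0.
  split=> [x y /JI Ix /JI Iy|a x /JI Ix]; apply: IJ; first exact: idealD.
  exact: idealM.
split=> [|k /(chain_of_lengthP _ iI) cI].
  apply/chain_of_lengthP => //; apply: (ideal_chain_ext iI IJ JI).
  exact/chain_of_lengthP.
by apply: mJ; apply/chain_of_lengthP => //; apply: (ideal_chain_ext iJ JI IJ).
Qed.

(** * Noetherian rings: associated primes and prime filtrations *)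

Section Noetherian.
Hypothesis noethA : noetherian A.

(** Without a maximal member, choice produces a strictly increasing sequence in [F]. *)
Lemma noetherian_maximal (F : (A -> Prop) -> Prop) I0 :
  (forall I, F I -> is_ideal I) -> F I0 ->
  exists2 M, F M & forall J, F J -> incl_set M J -> incl_set J M.
Proof.
move=> iF F0; apply: NNPP => nmax.
have next M : F M -> exists J, [/\ F J, incl_set M J & ~ incl_set J M].
  move=> FM; apply: NNPP => nJ; apply: nmax; exists M => // J FJ MJ.
  by apply: NNPP => nJM; apply: nJ; exists J.
have nextT (M : sig F) : exists J : sig F,
    incl_set (sval M) (sval J) /\ ~ incl_set (sval J) (sval M).
  by case: M => M FM; have [J [FJ MJ JM]] := next M FM; exists (exist _ J FJ).
have [f fP] := choice _ nextT.
pose s n := sval (iter n f (exist _ I0 F0)).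
have [||N sN] := noethA (I := s).
- by move=> n; apply: iF; rewrite /s; case: (iter _ _ _).
- by move=> n; have [] := fP (iter n f (exist _ I0 F0)).
by have [_] := fP (iter N f (exist _ I0 F0)); apply; apply: (sN N.+1).
Qed.

Lemma noetherian_ind (P : (A -> Prop) -> Prop) :
  (forall I, is_ideal I ->
     (forall J, is_ideal J -> incl_set I J -> ~ incl_set J I -> P J) -> P I) ->
  forall I, is_ideal I -> P I.
Proof.
move=> step I0 iI0; apply: NNPP => nP0.
have [||M [iM nPM] maxM] :=
  @noetherian_maximal (fun I => is_ideal I /\ ~ P I) I0; [by move=> I [] | by [] |].
apply: nPM; apply: step => // J iJ MJ nJM; apply: NNPP => nPJ.
by apply: nJM; apply: maxM.
Qed.

Lemma proper_sub_maximal I : proper_ideal I ->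
  exists2 M, maximal_ideal M & incl_set I M.
Proof.
move=> pI.
have [||M [pM IM] maxM] :=
    @noetherian_maximal (fun J => proper_ideal J /\ incl_set I J) I.
- by move=> J [[]].
- by split.
exists M => //; split=> // J pJ MJ; apply: maxM => //; split=> //.
by move=> x /IM /MJ.
Qed.

(** An associated prime of [A/I]: a colon that is maximal among those by elements outside [I] is
    prime. *)
Lemma exists_prime_colon I : proper_ideal I ->
  exists x, ~ I x /\ prime_ideal (colon I x).
Proof.
move=> [iI nI1].
have [||Q [x nIx QE] maxQ] :=
  @noetherian_maximal (fun J => exists2 x, ~ I x & J = colon I x) (colon I 1).
- by move=> J [x _ ->]; apply: ideal_colon.
- by exists 1.
exists x; split=> //; rewrite -QE; split.
  by rewrite QE; split; [exact: ideal_colon|rewrite /colon mul1r].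
move=> a b Qab; have [Qb|nQb] := classic (Q b); [by right|left].
have nIbx : ~ I (b * x) by move: nQb; rewrite QE.
(* [colon I (b * x)] contains [colon I x], so by maximality the two agree, and [a] lies in the
   former. *)
apply: (maxQ (colon I (b * x))); first by exists (b * x).
  by rewrite QE /colon => r Irx; rewrite mulrCA; apply: idealM.
by move: Qab; rewrite QE /colon mulrA.
Qed.

(** Noetherian induction: choose [x] with [K : x] prime; then [(K + Ax)/K] is isomorphic to
    [A/(K : x)], and [K + Ax] is filtered already. The second clause serves to find minimal primes;
    the third records the filtration through its effect on lengths modulo an arbitrary [I]. *)
Lemma prime_filtration K : is_ideal K ->
  exists (r : nat) (q : nat -> A -> Prop),
  [/\ forall i, (i < r)%N -> prime_ideal (q i),
      forall Q, prime_ideal Q -> incl_set K Q ->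
        exists2 i, (i < r)%N & incl_set (q i) Q
    & forall I (f : nat -> nat), is_ideal I ->
        (forall i, (i < r)%N -> len_le (add_ideal (q i) I) (f i)) ->
        len_le (add_ideal K I) (\sum_(i < r) f i)].
Proof.
move: K; apply: noetherian_ind => K iK IH.
have [K1|nK1] := classic (K 1).
  exists 0%N, (fun _ => K); split=> // [Q [[_ nQ1] _] KQ|I f iI _].
    by case: nQ1; apply: KQ.
  by apply: len_le_top => x; apply: sub_add_ideall => //; apply: ideal_full.
have [x [nKx pq]] := exists_prime_colon (conj iK nK1).
have iKx := ideal_adjoin x iK.
have [|r [q [qP qQ qlen]]] := IH _ iKx (@sub_adjoin _ _).
  by move=> /(_ x (mem_adjoin x iK)).
exists r.+1, (fun i => if i is i'.+1 then q i' else colon K x).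
split=> [[|i]//|Q pQ KQ|I f iI flen]; first exact: qP.
  have iQ : is_ideal Q by case: pQ => -[].
  have [Qx|nQx] := classic (Q x).
    by have [|i ir qiQ] := qQ Q pQ; [exact: adjoin_sub|exists i.+1].
  (* If [x] is not in [Q], then [r' * x] in [K], hence in [Q], forces [r'] into [Q]. *)
  exists 0%N => // r' /KQ /(proj2 pQ)[//|Qx]; by case: nQx.
have iKI := ideal_add_ideal iK iI.
(* [(K + I) + Ax] contains [(K + Ax) + I], and [(K + I) : x] contains [(K : x) + I]. *)
rewrite big_ord_recl addnC; apply: (len_le_adjoin_colon (x := x)).
  apply: (@len_le_sub (add_ideal (adjoin K x) I)); first exact: ideal_add_ideal.
    apply: add_ideal_sub; first exact: ideal_adjoin.
      apply: adjoin_sub; [exact: ideal_adjoin| |exact: mem_adjoin].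
      by move=> y Ky; apply/sub_adjoin/sub_add_ideall.
    by move=> y Iy; apply/sub_adjoin/sub_add_idealr.
  by apply: (qlen I (fun i => f i.+1)) => // i ir; apply: (flen i.+1).
apply: (@len_le_sub (add_ideal (colon K x) I)); last exact: (flen 0%N).
  by apply: ideal_add_ideal => //; apply: ideal_colon.
apply: add_ideal_sub; first exact: ideal_colon.
  by move=> y Ky; apply: sub_add_ideall.
move=> y Iy; apply: sub_add_idealr => //; rewrite mulrC; exact: idealM.
Qed.

(** Among the finitely many primes of a filtration of [A], take one in [Q] that is minimal within
    the family. A prime below it contains a member of the family, so it cannot be strictly
    smaller. *)
Lemma prime_contains_minimal_prime Q : prime_ideal Q ->
  exists2 p, minimal_prime p & incl_set p Q.
Proof.
move=> pQ; have iz : is_ideal (fun x : A => x = 0).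
  by split=> //; split=> [x y -> ->|a x ->]; rewrite ?addr0 ?mulr0.
have [r [q [qP qQ _]]] := prime_filtration iz.
have zsub P : prime_ideal P -> incl_set (fun x => x = 0) P.
  by move=> [[iP _] _] x ->; apply: ideal0.
have [i ir [iQ imin]] := finite_family_minimal (qQ Q pQ (zsub Q pQ)).
exists (q i) => //; split; first exact: qP.
move=> P pP Pqi; have [j jr qjP] := qQ P pP (zsub P pP).
by move=> x /(imin j jr (fun y qy => Pqi y (qjP y qy))) /qjP.
Qed.

(** Shrinking each prime of a filtration to a minimal prime inside it can only increase the lengths
    on the right, so the bound survives. *)
Lemma minimal_prime_filtration : exists (r : nat) (p : nat -> A -> Prop),
  (forall i, (i < r)%N -> minimal_prime (p i)) /\
  forall I (f : nat -> nat), is_ideal I ->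
    (forall i, (i < r)%N -> len_le (add_ideal (p i) I) (f i)) ->
    len_le I (\sum_(i < r) f i).
Proof.
have iz : is_ideal (fun x : A => x = 0).
  by split=> //; split=> [x y -> ->|a x ->]; rewrite ?addr0 ?mulr0.
have [r [q [qP _ qlen]]] := prime_filtration iz.
have /choice[p pP] i : exists p, (i < r)%N -> minimal_prime p /\ incl_set p (q i).
  case: (ltnP i r) => [ir|_]; last by exists (q i).
  by have [p] := prime_contains_minimal_prime (qP i ir); exists p.
exists r, p; split=> [i /pP[]//|I f iI flen].
apply: len_le_sub (qlen I f iI _); first exact: ideal_add_ideal.
  by move=> _ [_ [y [-> Iy ->]]]; rewrite add0r.
move=> i ir; have [[[[ipi _] _] _] piq] := pP i ir.
have iqi : is_ideal (q i) by case: (qP i ir) => -[].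
apply: len_le_sub (flen i ir); first exact: ideal_add_ideal.
apply: add_ideal_sub; first exact: ideal_add_ideal.
  by move=> x /piq; apply: sub_add_ideall.
exact: sub_add_idealr.
Qed.

(** * Local rings and extension of ideals along a self-map *)

Variable m : A -> Prop.
Hypothesis locA : local_ring m.

Lemma local_proper_sub I : proper_ideal I -> incl_set I m.
Proof.
by move=> /proper_sub_maximal[M maxM IM] x /IM /(proj2 locA M maxM).
Qed.

(** Otherwise the principal ideal of [1 - y] lies in [m], and so does [1 = (1 - y) + y]. *)
Lemma local_unit_1B y : m y -> exists u, u * (1 - y) = 1.
Proof.
move=> my; apply: NNPP => nu.
have iu : is_ideal (fun z => exists r, z = r * (1 - y)).
  split; first by exists 0; rewrite mul0r.
  split=> [_ _ [a ->] [b ->]|a _ [b ->]].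
    by exists (a + b); rewrite mulrDl.
  by exists (a * b); rewrite mulrA.
have [[im nm1] _] := proj1 locA.
apply: nm1; rewrite -(subrK y 1); apply: idealD => //.
apply: (local_proper_sub (I := fun z => exists r, z = r * (1 - y))).
  by split=> // -[r rE]; apply: nu; exists r.
by exists 1; rewrite mul1r.
Qed.

Section SelfMap.
Variables (f : A -> A) (p : A -> Prop).
Hypotheses (fD : {morph f : x y / x + y}) (fM : {morph f : x y / x * y}).
Hypothesis idp : is_ideal p.

(** The ideal [p + f(I)A]. When [f] preserves [p], it represents in [A] the extension of the image
    of [I] along the map induced on [A/p]. *)
Definition extend I := add_ideal p (ideal_gen (image_set f I)).

Lemma ideal_extend I : is_ideal (extend I).
Proof. by apply: ideal_add_ideal => //; apply: ideal_ideal_gen. Qed.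

Lemma mem_extend I x : I x -> extend I (f x).
Proof. by move=> Ix; apply: sub_add_idealr => //; apply: mem_ideal_gen; exists x. Qed.

Lemma extend_sub I J : is_ideal J -> incl_set p J -> (forall x, I x -> J (f x)) ->
  incl_set (extend I) J.
Proof.
move=> iJ pJ IJ; apply: add_ideal_sub => // x Sx; apply: Sx => //.
by move=> _ [y [/IJ Jfy ->]].
Qed.

(* In a chain of maximal length from [J], the first step may be taken to be
   [J < J + Ax], and [m x] lies in [J] by Nakayama. *)
Lemma len_le_extend (la k : nat) J : f 1 = 1 -> len_le (extend m) la ->
  ideal_chain J k -> len_le J k -> len_le (extend J) (k * la).
Proof.
move=> f1 lenm; elim: k J => [|k IH] J cJ lenJ.
  apply: len_le_top; apply: ideal_full; first exact: ideal_extend.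
  rewrite -f1; apply: mem_extend.
  by inversion cJ.
have iJ := ideal_chain_ideal cJ.
have [J' [JJ' J'J cJ']] : exists J', [/\ incl_set J J', ~ incl_set J' J & ideal_chain J' k].
  by inversion cJ; eexists; split; eassumption.
have [x [J'x nJx]] : exists x, J' x /\ ~ J x.
  by apply: NNPP => nx; apply: J'J => x J'x; apply: NNPP => nJx; apply: nx; exists x.
have iJx := ideal_adjoin x iJ.
have [k' kk' cJx] : exists2 k', (k <= k')%N & ideal_chain (adjoin J x) k'.
  apply: (ideal_chain_sub iJx _ cJ'); apply: adjoin_sub => //.
  exact: ideal_chain_ideal cJ'.
have below L l : is_ideal L -> incl_set J L -> ~ incl_set L J -> ideal_chain L l -> (l <= k)%N.
  by move=> iL JL LJ cL; rewrite -ltnS; apply/lenJ/(ideal_chain_step iJ JL LJ cL).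
have nJxJ : ~ incl_set (adjoin J x) J by move=> /(_ x (mem_adjoin x iJ)).
have lenJx : len_le (adjoin J x) k.
  by move=> l; apply: below => //; apply: sub_adjoin.
have k'E : k' = k by apply/eqP; rewrite eqn_leq kk' (lenJx _ cJx).
rewrite {}k'E in cJx.
have mx y : m y -> J (y * x).
  move=> my; apply: NNPP => nJyx; have iJyx := ideal_adjoin (y * x) iJ.
  have [|nJyxx] := classic (adjoin J (y * x) x).
    move=> [z [r [Jz xE]]]; have [im _] := proj1 (proj1 locA).
    have [u uE] := local_unit_1B (idealM r im my).
    apply: nJx; have -> : x = u * z.
      rewrite -[x in LHS]mul1r -uE -mulrA; congr (u * _).
      by rewrite mulrBl mul1r {1}xE mulrA addrK.
    exact: idealM.
  (* Otherwise [J < J + Ayx < J + Ax] are strict, giving a chain of length [k + 2] from [J]. *)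
  have: (k.+1 <= k)%N; last by rewrite ltnn.
  apply: (below (adjoin J (y * x))) => //; first exact: sub_adjoin.
    by move=> /(_ (y * x) (mem_adjoin (y * x) iJ)).
  apply: (ideal_chain_step iJyx _ _ cJx); last by move=> /(_ x (mem_adjoin x iJ)).
  apply: adjoin_sub => //; first exact: sub_adjoin.
  by apply: idealM => //; apply: mem_adjoin.
have iQ := ideal_extend J.
(* Adjoining [f x] to [extend J] gives an ideal containing [extend (J + Ax)], bounded by induction;
   the colon by [f x] contains [extend m], because [f] sends [m x] into [f(J)]. *)
rewrite mulSn addnC; apply: (len_le_adjoin_colon (x := f x)).
  apply: len_le_sub (IH _ cJx lenJx); first exact: ideal_extend.
  apply: extend_sub; first exact: ideal_adjoin.
    by move=> y py; apply/sub_adjoin/sub_add_ideall => //; apply: ideal_ideal_gen.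
  move=> _ [y [r [Jy ->]]]; rewrite fD fM; exists (f y), (f r); split=> //.
  exact: mem_extend.
apply: len_le_sub lenm; first exact: ideal_extend.
apply: extend_sub; first exact: ideal_colon.
  move=> y py; rewrite /colon mulrC; apply: idealM => //.
  by apply: sub_add_ideall => //; apply: ideal_ideal_gen.
by move=> y my; rewrite /colon -fM; apply/mem_extend/mx.
Qed.

End SelfMap.

Lemma iter_rmorphism (phi : {rmorphism A -> A}) n :
  [/\ iter n phi 0 = 0, iter n phi 1 = 1, {morph iter n phi : x y / x + y}
    & {morph iter n phi : x y / x * y}].
Proof.
elim: n => [|n [h0 h1 hD hM]]; first by split.
by split=> [||x y|x y]; rewrite iterS ?h0 ?h1 ?hD ?hM ?rmorph0 ?rmorph1 ?rmorphD ?rmorphM.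
Qed.

(** Submultiplicativity in [A/p]: [len_le_extend] is applied to [phi^a] and [J = p + phi^b(m)A],
    whose extension stays inside [p + phi^(a+b)(m)A] since [phi] preserves [p]. *)
Lemma len_le_extend_iter (phi : {rmorphism A -> A}) p a b la lb :
  is_ideal p -> (forall x, p x -> p (phi x)) ->
  len_le (extend (iter a phi) p m) la -> length_quot (extend (iter b phi) p m) lb ->
  len_le (extend (iter (a + b) phi) p m) (lb * la).
Proof.
move=> ip phip lena lenb; have [a0 a1 aD aM] := iter_rmorphism phi a.
set J := extend (iter b phi) p m in lenb.
have iJ : is_ideal J by apply: ideal_extend.
have iab n I : is_ideal (extend (iter n phi) p I) by apply: ideal_extend.
have sub_ext n I : incl_set p (extend (iter n phi) p I).
  by move=> x px; apply: sub_add_ideall => //; apply: ideal_ideal_gen.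
have piter n x : p x -> p (iter n phi x) by elim: n => // n IH /IH; apply: phip.
apply: (@len_le_sub (extend (iter a phi) p J)) => //; last first.
  apply: len_le_extend => //; last exact: length_quot_len_le lenb.
  by apply/chain_of_lengthP => //; case: lenb.
apply: extend_sub => //.
(* The preimage of the target under [phi^a] is an ideal containing [p] and [phi^b(m)], hence all of
   [J]. *)
pose K x := extend (iter (a + b) phi) p m (iter a phi x).
have iK : is_ideal K.
  rewrite /K; split; first by rewrite a0; apply: ideal0.
  split=> [x y Kx Ky|r x Kx]; first by rewrite aD; apply: idealD.
  by rewrite aM; apply: idealM.
apply: (@extend_sub _ _ m K) => // [x px|x mx].
  by apply: sub_ext; apply: piter.
by rewrite /K -iterD; apply: mem_extend.
Qed.

End Noetherian.
End Ideals.

(** * Transport of chains, lengths and maximal ideals along a surjection *)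

Section Quotient.
Variables (A B : comNzRingType) (pi : {rmorphism A -> B}).
Hypothesis pi_surj : forall b, exists x, pi x = b.
Implicit Types (I M : B -> Prop) (J : A -> Prop).

Definition preim_ideal I : A -> Prop := fun x => I (pi x).
Definition image_ideal J : B -> Prop := fun b => exists2 x, J x & b = pi x.

Lemma ideal_preim I : is_ideal I -> is_ideal (preim_ideal I).
Proof.
move=> iI; rewrite /preim_ideal; split; first by rewrite rmorph0; apply: ideal0.
split=> [x y Ix Iy|a x Ix]; first by rewrite rmorphD; apply: idealD.
by rewrite rmorphM; apply: idealM.
Qed.

Lemma ideal_image J : is_ideal J -> is_ideal (image_ideal J).
Proof.
move=> iJ; split; first by exists 0; [apply: ideal0|rewrite rmorph0].
split=> [_ _ [x Jx ->] [y Jy ->]|b _ [x Jx ->]].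
  by exists (x + y); [apply: idealD|rewrite rmorphD].
by have [a <-] := pi_surj b; exists (a * x); [apply: idealM|rewrite rmorphM].
Qed.

Lemma preim_image J x : is_ideal J -> (forall y, pi y = 0 -> J y) ->
  image_ideal J (pi x) -> J x.
Proof.
move=> iJ kJ [y Jy xy]; rewrite -(subrK y x); apply: idealD => //.
by apply: kJ; rewrite rmorphB xy subrr.
Qed.

Lemma ideal_chain_preim I k : ideal_chain I k -> ideal_chain (preim_ideal I) k.
Proof.
elim=> {I k}[I IT|I I' k iI II' I'I _ IH]; first by constructor=> x; apply: IT.
apply: ideal_chain_step IH; [exact: ideal_preim|by move=> x /II'|].
by move=> sub; apply: I'I => b; have [x <-] := pi_surj b; apply: sub.
Qed.

Lemma ideal_chain_image J k : (forall y, pi y = 0 -> J y) ->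
  ideal_chain J k -> ideal_chain (image_ideal J) k.
Proof.
move=> + cJ; elim: cJ => {J k}[J JT|J J' k iJ JJ' J'J _ IH] kJ.
  by constructor=> b; have [x <-] := pi_surj b; exists x.
apply: ideal_chain_step (IH _); first exact: ideal_image.
- by move=> _ [x /JJ' Jx ->]; exists x.
- move=> sub; apply: J'J => x J'x; apply: preim_image => //.
  by apply: sub; exists x.
- by move=> y /kJ /JJ'.
Qed.

(** The correspondence of ideals: strict chains over [I] and over its preimage are exchanged by
    preimage and image. *)
Lemma length_quot_preim I l : is_ideal I ->
  length_quot (preim_ideal I) l -> length_quot I l.
Proof.
move=> iI; have iP := ideal_preim iI; move=> [/(chain_of_lengthP _ iP) cP mP].
split=> [|k /(chain_of_lengthP _ iI) cI]; last first.
  by apply: mP; apply/chain_of_lengthP => //; apply: ideal_chain_preim.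
apply/chain_of_lengthP => //; apply: ideal_chain_ext (ideal_chain_image _ cP) => //.
- by move=> b Ib; have [x xb] := pi_surj b; exists x; rewrite /preim_ideal ?xb.
- by move=> _ [x Px ->].
- by move=> y y0; rewrite /preim_ideal y0; apply: ideal0.
Qed.

Lemma maximal_preim M : maximal_ideal M -> maximal_ideal (preim_ideal M).
Proof.
move=> [[iM nM1] maxM]; split.
  by split; [exact: ideal_preim|rewrite /preim_ideal rmorph1].
move=> J [iJ nJ1] MJ x Jx.
have kJ y : pi y = 0 -> J y.
  by move=> y0; apply: MJ; rewrite /preim_ideal y0; apply: ideal0.
apply: (maxM (image_ideal J)); last by exists x.
  split; first exact: ideal_image.
  by rewrite -(rmorph1 pi) => /(preim_image iJ kJ).
by move=> b; have [y <-] := pi_surj b => /(MJ y) Jy; exists y.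
Qed.

(** Preimages of maximal ideals of [B] are maximal in [A], hence all equal to [m]. *)
Lemma local_image (m : A -> Prop) : local_ring m -> (forall y, pi y = 0 -> m y) ->
  local_ring (image_ideal m).
Proof.
move=> [[[im nm1] maxm] uniqm] km.
have maxim : maximal_ideal (image_ideal m).
  split=> [|J [iJ nJ1] mJ b].
    split; first exact: ideal_image.
    by rewrite -(rmorph1 pi) => /(preim_image im km).
  have [x <-] := pi_surj b => Jx; exists x => //.
  apply: (maxm (preim_ideal J)) => //; last by move=> y my; apply: mJ; exists y.
  by split; [exact: ideal_preim|rewrite /preim_ideal rmorph1].
split=> // M maxM b; have Mm := uniqm _ (maximal_preim maxM).
have [x <-] := pi_surj b; split=> [Mx|/(preim_image im km) /(proj2 (Mm x)) //].
by exists x => //; apply: (proj1 (Mm x)).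
Qed.

Variables (phi : {rmorphism A -> A}) (psi : {rmorphism B -> B}) (p : A -> Prop).
Hypotheses (ip : is_ideal p) (pi_ker : forall x, pi x = 0 <-> p x).
Hypothesis pi_phi : forall x, psi (pi x) = pi (phi x).

Lemma iter_pi n x : iter n psi (pi x) = pi (iter n phi x).
Proof. by elim: n => //= n ->; rewrite pi_phi. Qed.

(** The preimage under [pi] of the ideal generated by [psi^n(pi(m))] is [p + phi^n(m)A]. *)
Lemma lambda_len_image (m : A -> Prop) n l :
  length_quot (extend (iter n phi) p m) l -> lambda_len (image_ideal m) psi n l.
Proof.
move=> len; apply: length_quot_preim; first exact: ideal_ideal_gen.
have iE := ideal_extend (iter n phi) ip m.
have iG := ideal_preim (ideal_ideal_gen (image_set (iter n psi) (image_ideal m))).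
apply: length_quot_ext len => //.
  move=> x Gx; apply: preim_image => //.
    by move=> y /pi_ker py; apply: sub_add_ideall => //; apply: ideal_ideal_gen.
  apply: Gx; first exact: ideal_image.
  move=> _ [_ [[y my ->] ->]]; rewrite iter_pi.
  by exists (iter n phi y) => //; apply: mem_extend.
apply: extend_sub => // [x /pi_ker x0|x mx].
  by rewrite /preim_ideal x0; apply: ideal0; apply: ideal_ideal_gen.
rewrite /preim_ideal -iter_pi; apply: mem_ideal_gen.
by exists (pi x); split=> //; exists x.
Qed.

Lemma lambda_len_quotient_le (m : A -> Prop) (n : B -> Prop) i l l' :
  local_ring m -> local_ring n ->
  lambda_len m phi i l -> lambda_len n psi i l' -> (l' <= l)%N.
Proof.
move=> [_ uniqm] [maxn _] lenl [/(chain_of_lengthP _ (ideal_ideal_gen _)) cB _].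
have c' := ideal_chain_preim cB.
(* The preimage of [n] is maximal, so it is [m]; the pulled-back chain therefore starts above
   [phi^i(m)A]. *)
have mn x : m x -> n (pi x) by move=> /(proj2 (uniqm _ (maximal_preim maxn) x)).
have iG := @ideal_ideal_gen _ (image_set (iter i phi) m).
have [|k l'k ck] := ideal_chain_sub iG _ c'.
  move=> x Gx; apply: Gx; first by apply: ideal_preim; apply: ideal_ideal_gen.
  move=> _ [y [my ->]]; rewrite /preim_ideal -iter_pi.
  by apply: mem_ideal_gen; exists (pi y); split=> //; apply: mn.
by apply: leq_trans l'k _; apply: length_quot_len_le lenl _ ck.
Qed.

End Quotient.

(** * Construction of the quotient ring and its induced self-map *)

Definition set_pred (T : Type) (p : T -> Prop) : {pred T} :=
  fun x => if excluded_middle_informative (p x) then true else false.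

Lemma set_predP (T : Type) (p : T -> Prop) x : reflect (p x) (x \in set_pred p).
Proof. by rewrite unfold_in; case: excluded_middle_informative => h; constructor. Qed.

(** The quotient is formed from a boolean predicate, whence [set_pred]. The induced map applies
    [phi] to a chosen representative; stability of [p] makes the choice immaterial. *)
Lemma exists_quotient_selfmap (A : comNzRingType) (phi : {rmorphism A -> A})
    (p : A -> Prop) :
  proper_ideal p -> (forall x, p x -> p (phi x)) ->
  exists (B : comNzRingType) (pi : {rmorphism A -> B}) (psi : {rmorphism B -> B}),
  [/\ forall b, exists x, pi x = b, forall x, pi x = 0 <-> p x
    & forall x, psi (pi x) = pi (phi x)].
Proof.
move=> [ip np1] phip.
have zp : zmod_closed (set_pred p).
  split; first by apply/set_predP; apply: ideal0.
  by move=> x y /set_predP px /set_predP py; apply/set_predP; apply: idealB.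
have pp : ring_quotient.proper_ideal (set_pred p).
  split; first by apply/negP => /set_predP.
  by move=> a x /set_predP px; apply/set_predP; apply: idealM.
pose I : idealr A := HB.pack (set_pred p)
  (GRing.isZmodClosed.Build A (set_pred p) zp) (isProperIdeal.Build A (set_pred p) pp).
pose B : comNzRingType := {ideal_quot I}.
pose pi : {rmorphism A -> B} := \pi_({ideal_quot I}).
have piE x y : pi x = pi y <-> p (x - y).
  split=> [/eqP xy|pxy]; first by apply/set_predP; rewrite (Quotient.idealrBE I).
  by apply/eqP; rewrite -(Quotient.idealrBE I); apply/set_predP.
have pi_surj b : exists x, pi x = b by exists (repr b); apply: reprK.
pose f (b : B) : B := pi (phi (repr b)).
have f_pi x : f (pi x) = pi (phi x).
  apply/piE; rewrite -rmorphB; apply: phip; apply/piE; exact: reprK.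
have fz : zmod_morphism f.
  move=> b c; have [x <-] := pi_surj b; have [y <-] := pi_surj c.
  by rewrite -rmorphB !f_pi !rmorphB.
have fm : monoid_morphism f.
  split=> [|b c]; first by rewrite -(rmorph1 pi) f_pi !rmorph1.
  have [x <-] := pi_surj b; have [y <-] := pi_surj c.
  by rewrite -rmorphM !f_pi !rmorphM.
pose psi : {rmorphism B -> B} := HB.pack f
  (GRing.isZmodMorphism.Build B B f fz) (GRing.isMonoidMorphism.Build B B f fm).
exists B, pi, psi; split=> // x.
by rewrite -(rmorph0 pi) piE subr0.
Qed.

(** * Growth rates of real sequences *)

Section RealSequences.
Local Open Scope R_scope.

(** Fekete's argument: remove blocks of length [k], each costing at most [c * k]; [d] accounts for
    the finitely many remainders below [k]. *)
Lemma subadditive_linear_bound (a : nat -> R) (k : nat) (c : R) : (0 < k)%N ->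
  (forall i j, a (i + j)%N <= a i + a j) -> a k <= c * INR k ->
  exists d, forall n, a n <= c * INR n + d.
Proof.
move=> k0 sub ak.
have [d dP] : exists d, forall n, (n < k)%N -> a n <= c * INR n + d.
  elim: k {k0 ak} => [|k [d dP]]; first by exists 0.
  exists (Rmax d (a k - c * INR k)) => n; rewrite ltnS leq_eqVlt => /orP[/eqP->|/dP nd].
    by have := Rmax_r d (a k - c * INR k); lra.
  by have := Rmax_l d (a k - c * INR k); lra.
exists d; elim/ltn_ind => n IH; have [/dP//|kn] := ltnP n k.
have := sub k (n - k)%N; have := IH (n - k)%N; rewrite subnKC //.
have -> : INR n = INR k + INR (n - k) by rewrite -plus_INR plusE subnKC.
rewrite ltn_subrL k0 (leq_trans k0 kn) => /(_ isT); lra.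
Qed.

Lemma slope_limit_le (a : nat -> R) (h c d : R) :
  Un_cv (fun n => a n / INR n) h -> (forall n, a n <= c * INR n + d) -> h <= c.
Proof.
move=> cva ac; apply: Rnot_lt_le => ch.
have e0 : (h - c) / 2 > 0 by lra.
(* For [n] beyond [N], [a n] exceeds [(h + c) / 2 * n]; beyond [k], this exceeds [c * n + d]. *)
have [N NP] := cva _ e0; have [k kP] := INR_unbounded (d / ((h - c) / 2)).
pose n := (N + k).+1.
have n0 : 0 < INR n by apply: lt_0_INR; apply/ltP.
have kn : INR k <= INR n by apply/le_INR/leP; rewrite leqW // leq_addl.
have /NP : (n >= N)%coq_nat by apply/leP; rewrite leqW // leq_addr.
rewrite /R_dist => /Rabs_def2 [_ lo].
have dn : d < (h - c) / 2 * INR n.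
  have := Rmult_lt_compat_r _ _ _ e0 kP.
  have -> : d / ((h - c) / 2) * ((h - c) / 2) = d by field; lra.
  by nra.
have an : a n = a n / INR n * INR n by field; lra.
have := ac n; nra.
Qed.

Lemma squeeze_cv (a b : nat -> R) (h : R) : (forall n, (0 < n)%N -> h <= a n <= b n) ->
  Un_cv b h -> Un_cv a h.
Proof.
(* The successor excludes the index 0, where the bounds are not assumed. *)
move=> hab cvb e e0; have [N NP] := cvb e e0; exists N.+1 => n /leP nN.
have /NP : (n >= N)%coq_nat by apply/leP/ltnW.
have := hab n (leq_trans (ltn0Sn N) nN).
by rewrite /R_dist => ? /Rabs_def2 ?; apply: Rabs_def1; lra.
Qed.

Lemma INR_exp_ln n : (0 < n)%N -> exp (ln (INR n)) = INR n.
Proof. by move=> n0; apply: exp_ln; apply: lt_0_INR; apply/ltP. Qed.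

Lemma le_ln (x y : R) : 0 < x -> x <= y -> ln x <= ln y.
Proof. by move=> x0 [xy|->]; [left; apply: ln_increasing|right]. Qed.

Lemma le_exp (x y : R) : x <= y -> exp x <= exp y.
Proof. by move=> [xy|->]; [left; apply: exp_increasing|right]. Qed.

(* [ln 0 = 0] in the standard library. *)
Lemma ln_INR_le m n : (m <= n)%N -> ln (INR m) <= ln (INR n).
Proof.
have INR0 k : 0 < INR k.+1 by apply: lt_0_INR; apply/ltP.
case: m n => [|m] [|n] mn //; try exact: Rle_refl.
  have -> : ln (INR 0) = ln 1.
    by rewrite ln_1 /= /ln; case: Rlt_dec => // lt; case: (Rlt_irrefl 0).
  by apply: le_ln; [lra|apply: (le_INR 1); apply/leP].
by apply: le_ln => //; apply/le_INR/leP.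
Qed.

Lemma sum_INR_le (f : nat -> nat) (r : nat) (M : R) :
  (forall i, (i < r)%N -> INR (f i) <= M) -> INR (\sum_(i < r) f i)%N <= INR r * M.
Proof.
elim: r => [|r IH] fM; first by rewrite big_ord0 /=; lra.
rewrite big_ord_recr [INR (_ + _)]plus_INR S_INR.
have := IH (fun i ir => fM i (ltnW ir)); have := fM r (leqnn _); rewrite /=; lra.
Qed.

(* If no [ln (lami i n) / n] tends to [h], then by Fekete's argument each
   [lami i n] is at most [exp (c n + d)] with a common [c < h], and so is their
   sum up to a constant factor, which keeps [ln (lam n) / n] away from [h]. *)
Lemma submultiplicative_sum_growth (lam : nat -> nat) (lami : nat -> nat -> nat)
    (r : nat) (h : R) :
  (forall n, (0 < lam n)%N) -> (forall n, (lam n <= \sum_(i < r) lami i n)%N) ->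
  (forall i n, (i < r)%N -> (0 < lami i n <= lam n)%N) ->
  (forall i j k, (i < r)%N -> (lami i (j + k) <= lami i j * lami i k)%N) ->
  Un_cv (fun n => ln (INR (lam n)) / INR n) h ->
  exists2 i, (i < r)%N & Un_cv (fun n => ln (INR (lami i n)) / INR n) h.
Proof.
move=> lam0 lamS lamP lamM cvl; apply: NNPP => nocv.
have bound i : (i < r)%N -> exists c d, c < h /\
    forall n, ln (INR (lami i n)) <= c * INR n + d.
  move=> ir; have pos n : (0 < lami i n)%N by have /andP[] := lamP i n ir.
  have INRpos (n : nat) : (0 < n)%N -> 0 < INR n by move=> n0; apply: lt_0_INR; apply/ltP.
  (* Either some slope is below [h] and serves as [c], or all slopes lie between [h] and those of
     [lam], and squeezing contradicts [nocv]. *)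
  have [[k k0 kh]|noc] := classic (exists2 k, (0 < k)%N & ln (INR (lami i k)) < h * INR k).
    have k0' := INRpos k k0.
    have kE : ln (INR (lami i k)) = ln (INR (lami i k)) / INR k * INR k by field; lra.
    have [||d dP] := @subadditive_linear_bound (fun n => ln (INR (lami i n))) k
       (ln (INR (lami i k)) / INR k) k0.
    - move=> a b; rewrite -ln_mult -?mult_INR; try exact: INRpos.
      by apply: ln_INR_le; apply: lamM.
    - exact: Req_le kE.
    - exists (ln (INR (lami i k)) / INR k), d; split=> //.
      by apply: (Rmult_lt_reg_r (INR k)) => //; lra.
  case: nocv; exists i => //; apply: squeeze_cv cvl => n n0; have n0' := INRpos n n0.
  split.
    apply: (Rmult_le_reg_r (INR n)) => //.
    have -> : ln (INR (lami i n)) / INR n * INR n = ln (INR (lami i n)) by field; lra.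
    by apply: Rnot_lt_le => lt; apply: noc; exists n.
  apply: Rmult_le_compat_r; first by apply/Rlt_le/Rinv_0_lt_compat.
  by apply: ln_INR_le; case/andP: (lamP i n ir).
have [c [d [ch cd]]] : exists c d, c < h /\ forall i, (i < r)%N ->
    forall n, ln (INR (lami i n)) <= c * INR n + d.
  elim: r {lamS lamP lamM nocv} bound => [|r IH] bound.
    by exists (h - 1), 0; split=> //; lra.
  have [c [d [ch cd]]] := IH (fun i ir => bound i (ltnW ir)).
  have [c' [d' [c'h cd']]] := bound r (leqnn _).
  exists (Rmax c c'), (Rmax d d'); split; first exact: Rmax_lub_lt.
  move=> i; rewrite ltnS leq_eqVlt => ir n; have := pos_INR n.
  have := Rmax_l c c'; have := Rmax_l d d'; have := Rmax_r c c'; have := Rmax_r d d'.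
  by case/orP: ir => [/eqP->|/cd /(_ n)]; [have := cd' n|]; nra.
suff : h <= c by lra.
(* The extra [INR r] absorbs the number of summands, as [r <= exp r]. *)
apply: (@slope_limit_le (fun n => ln (INR (lam n))) _ _ (d + INR r)) => // n.
rewrite -[X in _ <= X]ln_exp; apply: le_ln; first by apply: lt_0_INR; apply/ltP.
apply: (Rle_trans _ (INR (\sum_(i < r) lami i n)%N)); first exact/le_INR/leP.
have -> : c * INR n + (d + INR r) = INR r + (c * INR n + d) by ring.
rewrite exp_plus.
apply: (Rle_trans _ (INR r * exp (c * INR n + d))).
  apply: (@sum_INR_le (fun i => lami i n)) => i ir; rewrite -INR_exp_ln; last by case/andP: (lamP i n ir).
  by apply: le_exp; apply: cd.
apply: Rmult_le_compat_r; first exact/Rlt_le/exp_pos.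
by have := exp_ineq1_le (INR r); lra.
Qed.

Lemma slope_limits_le (a b : nat -> R) (g h : R) :
  (forall n, a n <= b n) -> Un_cv (fun n => a n / INR n) g ->
  Un_cv (fun n => b n / INR n) h -> g <= h.
Proof.
move=> ab cva cvb; apply: Rnot_lt_le => hg; have e0 : (g - h) / 2 > 0 by lra.
have [N NP] := cva _ e0; have [M MP] := cvb _ e0; pose n := (N + M).+1.
have /NP : (n >= N)%coq_nat by apply/leP; rewrite leqW // leq_addr.
have /MP : (n >= M)%coq_nat by apply/leP; rewrite leqW // leq_addl.
have n0 : 0 < / INR n by apply/Rinv_0_lt_compat/lt_0_INR/ltP.
have := Rmult_le_compat_r _ _ _ (Rlt_le _ _ n0) (ab n).
by rewrite /R_dist /Rdiv => ? /Rabs_def2 ? /Rabs_def2 ?; lra.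
Qed.

End RealSequences.

(** * Upper bound for the entropies of the quotients, and a prime attaining it *)

Theorem mainTheorem11 (R0 : comNzRingType) (m : R0 -> Prop)
  (phi : {rmorphism R0 -> R0})
  (hnoeth : noetherian R0) (hloc : local_ring m)
  (hfin : finite_length_selfmap m phi)
  (hmin : forall p : R0 -> Prop, minimal_prime p -> incl_set (ideal_gen (image_set phi p)) p)
  (h : R) (hh : alg_entropy m phi h) :
  (forall p : R0 -> Prop, minimal_prime p ->
     forall (B : comNzRingType) (pi : {rmorphism R0 -> B})
            (psi : {rmorphism B -> B}) (n : B -> Prop),
       induced_quotient phi p pi psi n ->
       forall hp, alg_entropy n psi hp -> Rle hp h) /\
  (exists p : R0 -> Prop, minimal_prime p /\
     exists (B : comNzRingType) (pi : {rmorphism R0 -> B})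
            (psi : {rmorphism B -> B}) (n : B -> Prop),
       induced_quotient phi p pi psi n /\ alg_entropy n psi h).
Proof.
have [lam [lamP cvl]] := hh; split.
  move=> p minp B pi psi n [pi_surj [_ [pi_phi locn]]] hp [lam' [lam'P cvl']].
  apply: slope_limits_le cvl' cvl => k; apply: ln_INR_le.
  exact: (lambda_len_quotient_le pi_surj pi_phi hloc locn (lamP k) (lam'P k)).
have [[[im nm1] _] _] := hloc; have [phim _] := hfin.
have phi_iter_m k x : m x -> m (iter k phi x).
  by elim: k x => // k IH x mx; rewrite iterS; apply: phim; exists (iter k phi x); split=> //; apply: IH.
have [r [p [pmin plen]]] := minimal_prime_filtration hnoeth.
(* The colength of [E i n] is the length for the [n]-th iterate on [R0/p_i]; the ideal is proper
   because [p_i] and [phi^n(m)] lie in [m]. *)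
pose E i n := extend (iter n phi) (p i) m.
have pid i : (i < r)%N -> proper_ideal (p i) by move=> /pmin[[]].
have pphi i x : (i < r)%N -> p i x -> p i (phi x).
  by move=> ir px; apply: (hmin _ (pmin i ir)); apply: mem_ideal_gen; exists x.
have pm i : (i < r)%N -> incl_set (p i) m.
  by move=> /pid; apply: (local_proper_sub hnoeth hloc).
have iE i n : (i < r)%N -> is_ideal (E i n).
  by move=> /pid[ip _]; apply: ideal_extend.
have nE1 i n : (i < r)%N -> ~ E i n 1.
  by move=> ir E1; apply: nm1; apply: (extend_sub im (pm i ir) _ E1) => x; apply: phi_iter_m.
have lenI n : len_le (ideal_gen (image_set (iter n phi) m)) (lam n).
  by apply: length_quot_len_le (lamP n); apply: ideal_ideal_gen.
have lenE i n : (i < r)%N -> len_le (E i n) (lam n).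
  move=> ir; apply: len_le_sub (lenI n); first exact: ideal_ideal_gen.
  by apply: sub_add_idealr; case: (pid i ir).
(* All the lengths are chosen at once as a function of the pair [(i, n)]; the value 0 for [i >= r]
   is a dummy. *)
have /choice[l lP] (u : nat * nat) : exists l, (u.1 < r)%N -> length_quot (E u.1 u.2) l.
  case: (ltnP u.1 r) => [ir|_]; last by exists 0%N.
  have [l lP] := length_quot_exists (iE _ _ ir) (nE1 _ u.2 ir) (lenE _ _ ir).
  by exists l.
(* Four goals check positivity, the filtration bound, the comparison with [lam] and
   submultiplicativity; the last continues with an index whose slopes tend to [h]. *)
have [||i n ir|i j k ir|i ir cvi] :=
    @submultiplicative_sum_growth lam (fun i n => l (i, n)) r h _ _ _ _ cvl.
- move=> n; apply: length_quot_gt0 (lamP n); first exact: ideal_ideal_gen.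
  move=> I1; apply: nm1; apply: I1 => // _ [x [mx ->]]; exact: phi_iter_m.
- move=> n; have [/(chain_of_lengthP _ (ideal_ideal_gen _)) c _] := lamP n.
  apply: (plen _ (fun i => l (i, n)) _ _ _ c); first exact: ideal_ideal_gen.
  by move=> i ir; apply: length_quot_len_le (iE i n ir) (lP (i, n) ir).
- rewrite (length_quot_gt0 (iE i n ir) (nE1 i n ir) (lP (i, n) ir)) /=.
  by apply: (lenE i n ir); apply/chain_of_lengthP; [exact: iE|case: (lP (i, n) ir)].
- have [ip _] := pid i ir; have pphi_i x := pphi i x ir.
  have lenj := length_quot_len_le (iE i j ir) (lP (i, j) ir).
  have := len_le_extend_iter hnoeth hloc ip pphi_i lenj (lP (i, k) ir).
  rewrite mulnC; apply; apply/chain_of_lengthP; first exact: (iE i (j + k)%N ir).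
  by case: (lP (i, j + k)%N ir).
exists (p i); split; first exact: pmin.
have [B [pi [psi [pi_surj pi_ker pi_phi]]]] :=
  exists_quotient_selfmap (pid i ir) (fun x => pphi i x ir).
exists B, pi, psi, (image_ideal pi m); split.
  split=> //; split=> //; split=> //; apply: local_image => // y /pi_ker.
  exact: pm.
exists (fun n => l (i, n)); split=> // n.
have [ip _] := pid i ir.
exact: (lambda_len_image pi_surj ip pi_ker pi_phi (lP (i, n) ir)).
Qed.
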